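(* Let $\rho = (1,k-1,1)$. For every integer $k \geq 1$, $$C_{3,2}^k = \vert \mathbb{S}(2^3,\rho) \vert = k^2+1.$$
   Context: $n^3$ denotes the three-row rectangular shape $(n,n,n)$. The Young diagram of shape $\lambda=(\lambda_1,\dots,\lambda_m)$ is the left-justified array with $\lambda_i$ cells in the $i$-th row from the top; $(i,j)$ is the cell in row $i$, column $j$. $\mathbb{S}(\lambda,\rho)$ is the set of standard set-valued Young tableaux of shape $\lambda$ and row-constant density $\rho=(\rho_1,\dots,\rho_m)$: assignments of the integers $1,\dots,M$, $M=\sum_i\lambda_i\rho_i$, to the cells so that each cell in row $i$ receives precisely $\rho_i$ integers (unordered within the cell), and for each cell $(i,j)$ every integer in it is smaller than every integer in the cells $(i+1,j)$ and $(i,j+1)$. In the degenerate case $k=1$ the middle-row cells are empty and the tableaux are identified with standard Young tableaux formed by the first and third rows, i.e. the order condition is read as: every integer in cell $(i,j)$ is smaller than every integer in any other cell $(i',j')$ with $i'\ge i$, $j'\ge j$ (for positive densities this is equivalent to the condition above). The numbers $C^k_{3,n} := \vert \mathbb{S}(n^3,\rho)\vert$ with $\rho=(1,k-1,1)$ are called the three-dimensional $k$-Catalan numbers. *)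

(* Defs.v *)
From HB Require Import structures.
From mathcomp Require Import all_boot.

Set Implicit Arguments.
Unset Strict Implicit.
Unset Printing Implicit Defensive.

Section SetValuedTableaux.

Variables (m : nat) (lam rho : m.-tuple nat).

(* Rows and columns are numbered from 0. *)
Definition cell := {i : 'I_m & 'I_(tnth lam i)}.
Definition row_of (c : cell) : nat := tag c.
Definition col_of (c : cell) : nat := tagged c.

Definition adjacent (c d : cell) : bool :=
  (row_of d == (row_of c).+1) && (col_of d == col_of c)
  || (row_of d == row_of c) && (col_of d == (col_of c).+1).

Definition dominated (c d : cell) : bool :=
  [&& c != d, row_of c <= row_of d & col_of c <= col_of d].

(* When some row has density 0 its cells are empty, so comparing adjacent cells
   only would lose the comparisons that pass through that row; the order
   condition is then imposed on all pairs of comparable cells.  For positive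
   densities (and lam a partition) the two conditions are equivalent. *)
Definition precedes (c d : cell) : bool :=
  if 0 \in rho then dominated c d else adjacent c d.

Definition total_content : nat := \sum_(i < m) tnth lam i * tnth rho i.

(* x : 'I_total_content stands for the integer x + 1, and T x is the cell that
   receives it; the set of integers in the cell c is the fibre of T over c. *)
Definition is_ssvt (T : {ffun 'I_total_content -> cell}) : bool :=
  [forall c : cell, #|[set x | T x == c]| == tnth rho (tag c)]
  && [forall x, forall y, precedes (T x) (T y) ==> (x < y)].

Definition SSVT : {set {ffun 'I_total_content -> cell}} :=
  [set T | is_ssvt T].

End SetValuedTableaux.

Definition rect3 (n : nat) : 3.-tuple nat := [tuple n; n; n].

(* Intended for 1 <= k, where k.-1 is the integer k - 1. *)
Definition catalan_density (k : nat) : 3.-tuple nat := [tuple 1; k.-1; 1].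

Definition catalan3 (k n : nat) : nat := #|SSVT (rect3 n) (catalan_density k)|.

(* Main.v *)
(** Let p and q be the positions of the entries of the cells (0,1) and (2,0), in
    0-based numbering, so that the positions 0 and 2k+1 belong to the corner
    cells (0,0) and (2,1).  The k-1 entries of (1,0) all precede the k-1 entries
    of (1,1), hence (p, q) determines the tableau.  Counting the entries that must
    come before or after a given one gives p <= k+1 and q >= k, and a second
    count shows p = k+1 iff q = k.  In every case (1,0) takes what is left of the
    positions 1..k and (1,1) what is left of k+1..2k.  So either
    (p, q) lies in [1,k] x [k+1,2k], which gives k^2 tableaux, or
    (p, q) = (k+1, k), which gives one more. *)
Require Import Defs.
From HB Require Import structures.
From mathcomp Require Import all_boot.
From mathcomp Require Import zify.

Lemma card_interval (a b n : nat) : b <= n ->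
  #|[set x : 'I_n | a <= x < b]| = b - a.
Proof.
move=> bn; rewrite cardsE -sum1_card.
rewrite -(big_mkord (fun x => a <= x < b) (fun=> 1)).
rewrite -(big_nat_widen 0 b n (fun x => a <= x) (fun=> 1)) //.
have [ab|ba] := leqP a b.
  rewrite (big_cat_nat _ ab) //= big_nat_cond big_pred0; last by move=> i; lia.
  rewrite add0n big_nat_cond (eq_bigl (fun i => a <= i < b)); last by move=> i; lia.
  by rewrite -big_nat sum_nat_const_nat muln1.
by rewrite big_nat_cond big_pred0 => [|i]; lia.
Qed.

(** * Bounds on an entry, for an arbitrary shape and density *)

Section GeneralShape.

Variables (m : nat) (lam rho : m.-tuple nat).

Lemma cell_eqE (c d : cell lam) :
  (c == d) = (row_of c == row_of d) && (col_of c == col_of d).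
Proof.
apply/eqP/andP => [-> //|[]]; case: c d => [i u] [j v]; rewrite /row_of /col_of /=.
by move=> /eqP/val_inj eij; case: _ / eij v => v /eqP/val_inj ->.
Qed.

Lemma adjacent_dominated (c d : cell lam) : adjacent c d -> dominated c d.
Proof. rewrite /adjacent /dominated cell_eqE; lia. Qed.

Lemma precedes_dominated (c d : cell lam) : precedes rho c d -> dominated c d.
Proof. by rewrite /precedes; case: ifP => // _; apply: adjacent_dominated. Qed.

Variable T : {ffun 'I_(total_content lam rho) -> cell lam}.

Hypothesis fiberT : forall c, #|[set x | T x == c]| = tnth rho (tag c).

Lemma card_fibers (s : seq (cell lam)) : uniq s ->
  #|[set x | T x \in s]| = \sum_(c <- s) tnth rho (tag c).
Proof.
elim: s => [_|c s IH /= /andP[cNs us]].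
  by rewrite big_nil; apply: eq_card0 => x; rewrite inE.
rewrite big_cons -IH // -fiberT -cardsUI.
rewrite [X in _ = _ + X]eq_card0 ?addn0; last first.
  by move=> x; rewrite !inE; apply: contraNF cNs => /andP[/eqP <-].
by apply: eq_card => x; rewrite !inE.
Qed.

Hypothesis ltT : forall x y, dominated (T x) (T y) -> x < y.

(** Every entry of a cell in [s] is smaller than [x], so these entries fit among the [x] positions
    below [x]. *)
Lemma lower_bound x (s : seq (cell lam)) : uniq s ->
  {in s, forall c, dominated c (T x)} -> \sum_(c <- s) tnth rho (tag c) <= x.
Proof.
move=> us sx; rewrite -card_fibers //.
have -> : x = #|[set y : 'I_(total_content lam rho) | y < x]| :> nat.
  by rewrite (card_interval 0) ?subn0 // ltnW.
by apply/subset_leq_card/subsetP => y; rewrite !inE => /sx /ltT.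
Qed.

(** The positions below [x] and the entries of [s] are disjoint and both avoid [x] itself, whence
    the strict inequality. *)
Lemma upper_bound x (s : seq (cell lam)) : uniq s ->
  {in s, forall c, dominated (T x) c} ->
  x + \sum_(c <- s) tnth rho (tag c) < total_content lam rho.
Proof.
move=> us sx; rewrite -card_fibers //.
have -> : x = #|[set y : 'I_(total_content lam rho) | y < x]| :> nat.
  by rewrite (card_interval 0) ?subn0 // ltnW.
rewrite -cardsUI [X in _ + X]eq_card0 ?addn0; last first.
  move=> y; rewrite !inE; apply/negP => /andP[yx /sx /ltT xy].
  by move: (ltn_trans yx xy); rewrite ltnn.
rewrite -[ltnRHS]card_ord; apply/proper_card/properP.
split; first exact/subsetP.
exists x => //; rewrite !inE ltnn /=; apply/negP => /sx.
by rewrite /dominated eqxx.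
Qed.

End GeneralShape.

(** * Three-row rectangles: from adjacent to comparable cells *)

Lemma tnth_rect3 n i : tnth (rect3 n) i = n.
Proof. by case: i => [[|[|[|]]]]. Qed.

Definition rect_cell n (i : 'I_3) (j : 'I_n) : cell (rect3 n) :=
  Tagged _ (cast_ord (esym (tnth_rect3 n i)) j).

Lemma row_rect_cell n i j : row_of (rect_cell n i j) = i.
Proof. by []. Qed.

Lemma col_rect_cell n i j : col_of (rect_cell n i j) = j.
Proof. by []. Qed.

Lemma row_lt3 n (c : cell (rect3 n)) : row_of c < 3.
Proof. exact: ltn_ord. Qed.

Lemma col_lt n (c : cell (rect3 n)) : col_of c < n.
Proof. by rewrite -[ltnRHS](tnth_rect3 n (tag c)) ltn_ord. Qed.

(* Follow a lattice path of cells from [T x] to [T y]; each one is nonempty. *)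
Lemma adjacent_lt_dominated_lt n (rho : 3.-tuple nat)
    (T : {ffun 'I_(total_content (rect3 n) rho) -> cell (rect3 n)}) :
    (forall c, exists x, T x = c) ->
    (forall x y, adjacent (T x) (T y) -> x < y) ->
  forall x y, dominated (T x) (T y) -> x < y.
Proof.
move=> onT adjT x y.
have [l] := ubnP (row_of (T y) - row_of (T x) + (col_of (T y) - col_of (T x))).
elim: l x => // l IH x ltl dxy.
have step z : adjacent (T x) (T z) -> row_of (T z) <= row_of (T y) ->
    col_of (T z) <= col_of (T y) -> x < y.
  move=> axz rzy czy; have xz := adjT _ _ axz.
  have [ezy|nzy] := eqVneq (T z) (T y); first by apply: adjT; rewrite -ezy.
  apply: (ltn_trans xz); apply: IH; last by rewrite /dominated nzy rzy.
  move: axz ltl dxy; rewrite /adjacent /dominated; lia.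
have ry := row_lt3 _ (T y); have cy := col_lt _ (T y).
move: (dxy); rewrite /dominated cell_eqE => /and3P[nxy rxy cxy].
have [rlt|rge] := ltnP (row_of (T x)) (row_of (T y)).
  have rx3 := leq_ltn_trans rlt ry; have cxn := col_lt _ (T x).
  have [z Tz] := onT (rect_cell _ (Ordinal rx3) (Ordinal cxn)).
  apply: (step z); rewrite /adjacent Tz ?row_rect_cell ?col_rect_cell /=; lia.
have clt : col_of (T x) < col_of (T y) by lia.
have cxn := leq_ltn_trans clt cy.
have [z Tz] := onT (rect_cell _ (Ordinal (row_lt3 _ (T x))) (Ordinal cxn)).
by apply: (step z); rewrite /adjacent Tz ?row_rect_cell ?col_rect_cell /=; lia.
Qed.

Section TwoColumns.

Variable k : nat.
Hypothesis k_gt0 : 0 < k.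

Local Notation rho := (catalan_density k).
Local Notation M := (total_content (rect3 2) rho).

Lemma total_contentE : M = (2 * k).+2.
Proof. rewrite /total_content !big_ord_recl big_ord0 !(tnth_nth 0) /=; lia. Qed.

Lemma tnth_densityE (c : cell (rect3 2)) :
  tnth rho (tag c) = if row_of c == 1 then k.-1 else 1.
Proof. by rewrite /row_of; case: c => [[[|[|[|i]]] lti] j]. Qed.

(** For [k = 1] the density contains 0 and [precedes] is dominance itself; otherwise every cell is
    nonempty and the comparison propagates along adjacent cells. *)
Lemma ssvt_lt (T : {ffun 'I_M -> cell (rect3 2)}) : is_ssvt T ->
  forall x y, dominated (T x) (T y) -> x < y.
Proof.
case/andP => /forallP fibT /forallP ltT.
have {}ltT x y : precedes rho (T x) (T y) -> x < y.
  by move=> pxy; have /forallP/(_ y)/implyP := ltT x; apply.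
move: ltT; rewrite /precedes; case rho0: (0 \in rho) => // ltT.
apply: adjacent_lt_dominated_lt => // c.
have : 0 < #|[set x | T x == c]|.
  rewrite (eqP (fibT c)) lt0n; apply: contraFN rho0 => /eqP rho_c.
  by have := mem_tnth (tag c) rho; rewrite rho_c.
by case/card_gt0P => x; rewrite inE => /eqP <-; exists x.
Qed.

(** * The explicit family of tableaux *)

(* The coordinates of the cell receiving [x] when [p] and [q] are the entries of
   the cells (0,1) and (2,0). *)
Definition entry_coord (p q x : nat) : nat * nat :=
  if x == 0 then (0, 0) else if x == (2 * k).+1 then (2, 1) else
  if x == p then (0, 1) else if x == q then (2, 0) else
  if x <= k then (1, 0) else (1, 1).

(* [None] encodes the exceptional tableau, in which [q < p]. *)
Definition entry01 (t : option ('I_k * 'I_k)) : nat :=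
  if t is Some (i, _) then i.+1 else k.+1.

Definition entry20 (t : option ('I_k * 'I_k)) : nat :=
  if t is Some (_, j) then k.+1 + j else k.

Lemma entryP t :
  [/\ 0 < entry01 t <= k & k < entry20 t <= 2 * k] \/
  (entry01 t = k.+1 /\ entry20 t = k).
Proof.
case: t => [[i j]|] /=; last by right.
by left; have := ltn_ord i; have := ltn_ord j; split; lia.
Qed.

(** The coordinates are always below 3 and 2, so the default value of [inord] never occurs. *)
Definition tableau t : {ffun 'I_M -> cell (rect3 2)} :=
  [ffun x : 'I_M => let ij := entry_coord (entry01 t) (entry20 t) x in
    rect_cell _ (inord ij.1) (inord ij.2)].

Lemma row_tableau t x :
  row_of (tableau t x) = (entry_coord (entry01 t) (entry20 t) x).1.
Proof.
rewrite ffunE /row_of /= inordK // /entry_coord.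
by do 5! case: ifP => // _.
Qed.

Lemma col_tableau t x :
  col_of (tableau t x) = (entry_coord (entry01 t) (entry20 t) x).2.
Proof.
rewrite ffunE /col_of /= inordK // /entry_coord.
by do 5! case: ifP => // _.
Qed.

Lemma tableau_eqE t x c : (tableau t x == c) =
  (entry_coord (entry01 t) (entry20 t) x == (row_of c, col_of c)).
Proof. by rewrite cell_eqE row_tableau col_tableau -pair_eqE. Qed.

(** [entry01 t] is the only position sent to (0,1) and [entry20 t] the only one sent to (2,0); these
    two numbers determine [t]. *)
Lemma tableau_inj : injective tableau.
Proof.
move=> t u etu.
have coord x : x < M -> entry_coord (entry01 t) (entry20 t) x =
                       entry_coord (entry01 u) (entry20 u) x.
  move=> xM; apply/eqP; rewrite -pair_eqE /=.
  have := row_tableau t (Ordinal xM); have := col_tableau t (Ordinal xM).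
  by rewrite etu row_tableau col_tableau => <- <-; rewrite !eqxx.
have tM : entry01 t < M by rewrite total_contentE; case: (entryP t); lia.
have tM' : entry20 t < M by rewrite total_contentE; case: (entryP t); lia.
have e01 : entry01 t = entry01 u.
  have /eqP := coord _ tM; rewrite -pair_eqE /entry_coord.
  by case: (entryP t); case: (entryP u); repeat case: ifP => /=; lia.
have e20 : entry20 t = entry20 u.
  have /eqP := coord _ tM'; rewrite -pair_eqE /entry_coord.
  by case: (entryP t); case: (entryP u); repeat case: ifP => /=; lia.
case: t u e01 e20 {etu coord tM tM'} => [[i j]|] [[i' j']|] //=.
- by move=> [/val_inj ->] /addnI /val_inj ->.
- by have := ltn_ord i; lia.
- by have := ltn_ord i'; lia.
Qed.

Lemma tableau_ssvt t : is_ssvt (tableau t).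
Proof.
apply/andP; split; last first.
  (* Checking all dominated pairs covers both forms of [precedes]. *)
  apply/forallP => x; apply/forallP => y; apply/implyP => /precedes_dominated.
  rewrite /dominated cell_eqE !row_tableau !col_tableau.
  have := ltn_ord x; have := ltn_ord y; rewrite {2 4}total_contentE /entry_coord.
  case: (entryP t); repeat case: ifP => /=; lia.
apply/forallP => c; rewrite tnth_densityE; apply/eqP.
have fiber1 z : z < (2 * k).+2 -> (forall x, x < (2 * k).+2 ->
    (entry_coord (entry01 t) (entry20 t) x == (row_of c, col_of c)) = (x == z)) ->
    #|[set x | tableau t x == c]| = 1.
  rewrite -total_contentE => zM zE; apply/eqP/cards1P; exists (Ordinal zM).
  by apply/setP => x; rewrite !inE tableau_eqE zE.
(* A middle cell receives a block of [k] consecutive positions with one of them, [z], removed. *)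
have fiberk a z : a + k <= (2 * k).+2 -> a <= z < a + k -> (forall x, x < (2 * k).+2 ->
    (entry_coord (entry01 t) (entry20 t) x == (row_of c, col_of c)) =
    (a <= x < a + k) && (x != z)) ->
    #|[set x | tableau t x == c]| = k.-1.
  rewrite -total_contentE => akM za zE; have zM : z < M by lia.
  have -> : [set x | tableau t x == c] = [set x : 'I_M | a <= x < a + k] :\ Ordinal zM.
    by apply/setP => x; rewrite !inE tableau_eqE zE // andbC.
  have := cardsD1 (Ordinal zM) [set x : 'I_M | a <= x < a + k].
  rewrite card_interval // inE za; lia.
move: fiber1 fiberk (row_lt3 _ c) (col_lt _ c).
case: (row_of c) => [|[|[|//]]]; case: (col_of c) => [|[|//]] fiber1 fiberk _ _ /=;
  [ apply: (fiber1 0) | apply: (fiber1 (entry01 t))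
  (* In both cases of [entryP], exactly one of p and q lies in 1..k, namely their minimum, and the
     maximum lies in k+1..2k. *)
  | apply: (fiberk 1 (minn (entry01 t) (entry20 t)))
  | apply: (fiberk k.+1 (maxn (entry01 t) (entry20 t)))
  | apply: (fiber1 (entry20 t)) | apply: (fiber1 (2 * k).+1) ] => *;
  rewrite -?pair_eqE /entry_coord; case: (entryP t); repeat case: ifP => /=; lia.
Qed.

(** * Every tableau belongs to the family *)

Local Notation C i j := (rect_cell 2 (inord i) (inord j)).

Lemma rect_cellE i j : i < 3 -> j < 2 ->
  (row_of (C i j) = i) * (col_of (C i j) = j).
Proof. by move=> i3 j2; rewrite row_rect_cell col_rect_cell !inordK. Qed.

(** Each range comes from adding up the densities of the cells that must precede or follow the cell
    of [x]. *)
Lemma ssvt_coord T (x : 'I_M) : is_ssvt T ->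
  [|| [&& row_of (T x) == 0, col_of (T x) == 0 & x == 0 :> nat],
      [&& row_of (T x) == 0, col_of (T x) == 1 & 0 < x <= k.+1],
      [&& row_of (T x) == 1, col_of (T x) == 0 & 0 < x <= k],
      [&& row_of (T x) == 1, col_of (T x) == 1 & k < x <= 2 * k],
      [&& row_of (T x) == 2, col_of (T x) == 0 & k <= x <= 2 * k] |
      [&& row_of (T x) == 2, col_of (T x) == 1 & x == (2 * k).+1 :> nat]].
Proof.
move=> ssT; have ltT := ssvt_lt _ ssT.
have fibT d : #|[set x | T x == d]| = tnth rho (tag d).
  by case/andP: ssT => /forallP/(_ d)/eqP.
(* Cells are listed as pairs of numbers so that distinctness and dominance are settled by
   computation. *)
pose cells := map (fun ij : nat * nat => C ij.1 ij.2).
pose valid (l : seq (nat * nat)) := uniq l && all (fun ij => (ij.1 < 3) && (ij.2 < 2)) l.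
pose weight l := foldr (fun ij n => (if ij.1 == 1 then k.-1 else 1) + n) 0 (l : seq (nat * nat)).
have uniq_cells l : valid l -> uniq (cells l).
  case/andP=> ul /allP vl; rewrite map_inj_in_uniq // => -[i j] [i' j'] /vl/andP[/= i3 j2].
  move=> /vl/andP[/= i3' j2'] /eqP; rewrite cell_eqE !rect_cellE //.
  by case/andP=> /eqP -> /eqP ->.
have weightE l : valid l -> \sum_(d <- cells l) tnth rho (tag d) = weight l.
  case/andP=> _; rewrite (eq_bigr _ (fun d _ => tnth_densityE d)) big_map.
  elim: l => [|[i j] l IH]; first by rewrite big_nil.
  by case/andP=> /andP[i3 j2] /IH {}IH; rewrite big_cons IH rect_cellE.
have lo l : valid l ->
    all (fun ij => [&& ij != (row_of (T x), col_of (T x)), ij.1 <= row_of (T x)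
                     & ij.2 <= col_of (T x)]) l -> weight l <= x.
  move=> vl /allP dl; rewrite -weightE //.
  apply: (lower_bound _ _ _ _ fibT ltT) => [|_ /mapP[[i j] ijl ->]]; first exact: uniq_cells.
  case/andP: vl => _ /allP/(_ _ ijl)/andP[/= i3 j2].
  by have := dl _ ijl; rewrite /dominated cell_eqE !rect_cellE.
have up l : valid l ->
    all (fun ij => [&& ij != (row_of (T x), col_of (T x)), row_of (T x) <= ij.1
                     & col_of (T x) <= ij.2]) l -> x + weight l < (2 * k).+2.
  move=> vl /allP dl; rewrite -weightE // -total_contentE.
  apply: (upper_bound _ _ _ _ fibT ltT) => [|_ /mapP[[i j] ijl ->]]; first exact: uniq_cells.
  case/andP: vl => _ /allP/(_ _ ijl)/andP[/= i3 j2].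
  have := dl _ ijl; rewrite /dominated cell_eqE !rect_cellE //.
  by rewrite -pair_eqE /= [row_of _ == i]eq_sym [col_of _ == j]eq_sym.
have := row_lt3 _ (T x); have := col_lt _ (T x).
case: (row_of (T x)) lo up => [|[|[|//]]]; case: (col_of (T x)) => [|[|//]] lo up _ _.
(* In each case [lo] and [up] are given all the cells below and above the current one; an empty list
   is omitted. *)
- have /= := up [:: (0, 1); (1, 0); (1, 1); (2, 0); (2, 1)] isT isT.
  rewrite /=; lia.
- have /= := up [:: (1, 1); (2, 1)] isT isT; have /= := lo [:: (0, 0)] isT isT.
  rewrite /=; lia.
- have /= := up [:: (1, 1); (2, 0); (2, 1)] isT isT; have /= := lo [:: (0, 0)] isT isT.
  rewrite /=; lia.
- have /= := lo [:: (0, 0); (0, 1); (1, 0)] isT isT; have /= := up [:: (2, 1)] isT isT.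
  rewrite /=; lia.
- have /= := lo [:: (0, 0); (1, 0)] isT isT; have /= := up [:: (2, 1)] isT isT.
  rewrite /=; lia.
- have /= := lo [:: (0, 0); (0, 1); (1, 0); (1, 1); (2, 0)] isT isT.
  have := ltn_ord x; rewrite {2}total_contentE.
  rewrite /=; lia.
Qed.

(** The ranges of the corner and middle cells are pairwise disjoint; only (0,1) and (2,0) overlap
    others, and the last two hypotheses decide those. *)
Lemma entry_coordE p q x r c :
  [|| [&& r == 0, c == 0 & x == 0],
      [&& r == 0, c == 1 & 0 < x <= k.+1],
      [&& r == 1, c == 0 & 0 < x <= k],
      [&& r == 1, c == 1 & k < x <= 2 * k],
      [&& r == 2, c == 0 & k <= x <= 2 * k] |
      [&& r == 2, c == 1 & x == (2 * k).+1]] ->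
  (r == 0) && (c == 1) = (x == p) -> (r == 2) && (c == 0) = (x == q) ->
  entry_coord p q x = (r, c).
Proof.
rewrite /entry_coord.
by case/orP=> [|/orP[|/orP[|/orP[|/orP[]]]]]; case/and3P => /eqP -> /eqP -> x_in /= /esym -> /esym ->;
  repeat case: ifP => //=; lia.
Qed.

Lemma ssvt_tableau T : is_ssvt T -> exists t, T = tableau t.
Proof.
move=> ssT; have coordT x := ssvt_coord T x ssT.
have fibT c : #|[set x | T x == c]| = if row_of c == 1 then k.-1 else 1.
  by rewrite -tnth_densityE; case/andP: ssT => /forallP/(_ c)/eqP.
have entry c : row_of c != 1 -> exists z : 'I_M, forall x : 'I_M, (T x == c) = (x == z :> nat).
  move=> rc; have /eqP/cards1P[z Tz] : #|[set x | T x == c]| = 1 by rewrite fibT (negPf rc).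
  by exists z => x; move/setP/(_ x): Tz; rewrite !inE.
have [|p Tp] := entry (C 0 1); first by rewrite rect_cellE.
have [|q Tq] := entry (C 2 0); first by rewrite rect_cellE.
have {}Tp x : (row_of (T x) == 0) && (col_of (T x) == 1) = (x == p :> nat).
  by rewrite -Tp cell_eqE !rect_cellE.
have {}Tq x : (row_of (T x) == 2) && (col_of (T x) == 0) = (x == q :> nat).
  by rewrite -Tq cell_eqE !rect_cellE.
(* Pigeonhole: a middle cell has only k-1 entries, so it cannot contain [k] consecutive
   positions. *)
have middle a j : j < 2 -> a + k <= M ->
    (forall x : 'I_M, a <= x < a + k -> (row_of (T x) == 1) && (col_of (T x) == j)) -> False.
  move=> j2 akM Tx.
  have /subset_leq_card : [set x : 'I_M | a <= x < a + k] \subset [set x | T x == C 1 j].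
    by apply/subsetP => x; rewrite !inE cell_eqE !rect_cellE //; apply: Tx.
  rewrite card_interval // fibT rect_cellE //=; lia.
have p_q : (p == k.+1 :> nat) = (q == k :> nat).
  have := Tp p; have := Tq q; rewrite !eqxx => pP qP.
  apply/eqP/eqP => [pk|qk].
    (* If p = k+1 and q > k, nothing but (1,0) is left for the positions 1..k. *)
    have [//|qk] := eqVneq (q : nat) k.
    case: (middle 1 0) => // [|x xk]; first by rewrite total_contentE; lia.
    have := coordT q; have := Tp x; have := Tq x; have := coordT x => /=; lia.
  (* If q = k and p <= k, nothing but (1,1) is left for the positions k+1..2k. *)
  have [//|pk] := eqVneq (p : nat) k.+1.
  case: (middle k.+1 1) => // [|x xk]; first by rewrite total_contentE; lia.
  have := coordT p; have := Tp x; have := Tq x; have := coordT x => /=; lia.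
(* By [p_q], either (p, q) = (k+1, k), or p <= k and q > k, where subtracting 1 and k+1 gives the
   indices. *)
have [t [tp tq]] : exists t, entry01 t = p /\ entry20 t = q.
  have := coordT p; have := coordT q; have := Tp p; have := Tq q.
  rewrite !eqxx /= => pP qP pB qB.
  have [pk|pk] := eqVneq (p : nat) k.+1.
    by exists None => /=; lia.
  have pk' : p.-1 < k by lia.
  have qk' : q - k.+1 < k by lia.
  by exists (Some (Ordinal pk', Ordinal qk')) => /=; lia.
exists t; apply/ffunP => x; apply/esym/eqP; rewrite tableau_eqE tp tq.
exact/eqP/(entry_coordE _ _ _ _ _ (coordT x)).
Qed.

Lemma card_ssvt : #|SSVT (rect3 2) rho| = k ^ 2 + 1.
Proof.
have -> : SSVT (rect3 2) rho = [set tableau t | t in setT].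
  apply/setP => T; rewrite inE; apply/idP/imsetP => [/(ssvt_tableau T)[t ->]|[t _ ->]].
    by exists t.
  exact: tableau_ssvt.
rewrite card_imset ?cardsT; last exact: tableau_inj.
by rewrite card_option card_prod card_ord addn1.
Qed.

End TwoColumns.

Theorem proposition3p1 (k : nat) (k_ge1 : 1 <= k) :
  catalan3 k 2 = #|SSVT (rect3 2) (catalan_density k)|
  /\ #|SSVT (rect3 2) (catalan_density k)| = k ^ 2 + 1.
Proof.
split=> //; exact: card_ssvt.
Qed.
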